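(* Let $m\ge1$ and $k\ge1$ be integers, and let $\lambda,\mu$ be permutations of $\{1,\dots,m\}$, both without self-overlaps, with $\lambda(1)=\mu(1)$ and $\lambda(m)=\mu(m)$. For a permutation $\nu$ of $\{1,\dots,m\}$ let $\tau_{k,\nu}=\nu\,(\nu+m)\,(\nu+2m)\cdots(\nu+(k-1)m)$, a permutation of $\{1,\dots,km\}$. Then for every $n\ge0$, the number of permutations of $\{1,\dots,n\}$ avoiding $\tau_{k,\lambda}$ equals the number of permutations of $\{1,\dots,n\}$ avoiding $\tau_{k,\mu}$. (That is, the number of permutations of length $n$ avoiding $\tau_{k,\lambda}$ depends only on $n$, $m$, $\lambda(1)$, $\lambda(m)$ and $k$.)
   Context: For a permutation $\nu$ of $\{1,\dots,m\}$ and an integer $j$, $\nu+j$ denotes the word obtained by adding $j$ to every entry of $\nu$; juxtaposition denotes concatenation of words. For a word $s=s_1\dots s_r$ of distinct integers, $\mathrm{st}(s)$ is the permutation $\rho$ of $\{1,\dots,r\}$ with $s_i<s_l\iff\rho_i<\rho_l$. A permutation $\sigma$ contains the pattern $\pi$ of length $r$ if $\mathrm{st}(\sigma_i\dots\sigma_{i+r-1})=\pi$ for some $i$ (an occurrence), and avoids it otherwise. A pattern of length $m$ has no self-overlaps if every permutation of length at most $2m-2$ has at most one occurrence of it. *)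

(* Defs.v *)
From mathcomp Require Import all_boot all_fingroup.
Set Implicit Arguments.
Unset Strict Implicit.
Unset Printing Implicit Defensive.

(* One-line notation with letters 1, ..., n; [sigma : 'S_n] acts on 'I_n,
   which starts at 0. *)
Definition oneline (n : nat) (sigma : 'S_n) : seq nat :=
  [seq (sigma i : nat).+1 | i <- enum 'I_n].

(* Each letter is replaced by its rank; [st_spec] below shows that, on words
   with distinct letters, this is the permutation of {1, ..., size s}
   order-isomorphic to s, and [st_unique] that it is the only one. *)
Definition st (s : seq nat) : seq nat := [seq count (leq^~ x) s | x <- s].

(* Positions are counted from 0. *)
Definition occurs_at (p s : seq nat) (i : nat) : bool :=
  (i + size p <= size s) && (st (take (size p) (drop i s)) == p).

Definition occurrences (p s : seq nat) : seq nat :=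
  [seq i <- iota 0 (size s).+1 | occurs_at p s i].

Definition contains (s p : seq nat) : bool := occurrences p s != [::].

Definition avoids (s p : seq nat) : bool := ~~ contains s p.

Definition no_self_overlaps (p : seq nat) : Prop :=
  forall (n : nat) (sigma : 'S_n),
    n <= 2 * size p - 2 -> size (occurrences p (oneline sigma)) <= 1.

Definition shift (j : nat) (w : seq nat) : seq nat := [seq x + j | x <- w].

Definition tau (k m : nat) (nu : 'S_m) : seq nat :=
  flatten [seq shift (j * m) (oneline nu) | j <- iota 0 k].

Definition avoiders (n : nat) (p : seq nat) : {set 'S_n} :=
  [set sigma : 'S_n | avoids (oneline sigma) p].

Lemma size_oneline n (sigma : 'S_n) : size (oneline sigma) = n.
Proof. by rewrite size_map size_enum_ord. Qed.

Lemma perm_oneline n (sigma : 'S_n) : perm_eq (oneline sigma) (iota 1 n).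
Proof.
apply: uniq_perm; [|exact: iota_uniq|].
  rewrite map_inj_uniq ?enum_uniq // => i j [] /val_inj; exact: perm_inj.
move=> x; rewrite mem_iota add1n ltnS; apply/mapP/andP => [[i _ ->]|[]].
  by rewrite ltn_ord.
case: x => // x _ ltxn.
by exists ((sigma^-1)%g (Ordinal ltxn)); rewrite ?mem_enum // permKV.
Qed.

Lemma oneline_surj n (s : seq nat) :
  perm_eq s (iota 1 n) -> exists sigma : 'S_n, oneline sigma = s.
Proof.
move=> ps; have szs: size s = n by rewrite (perm_size ps) size_iota.
have us: uniq s by rewrite (perm_uniq ps) iota_uniq.
have bs (i : 'I_n) : 0 < nth 0 s i <= n.
  have : nth 0 s i \in s by rewrite mem_nth // szs.
  by rewrite (perm_mem ps) mem_iota add1n ltnS.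
have lt (i : 'I_n) : (nth 0 s i).-1 < n.
  by case/andP: (bs i) => p0 pn; rewrite prednK.
have inj: injective (fun i => Ordinal (lt i)).
  move=> i j /(congr1 val) /= /(congr1 succn).
  case/andP: (bs i) => i0 _; case/andP: (bs j) => j0 _; rewrite !prednK //.
  by move/eqP; rewrite nth_uniq ?szs // => /eqP /val_inj.
exists (perm inj); apply: (@eq_from_nth _ 0) => [|i]; rewrite size_oneline //.
move=> ltin; rewrite (nth_map (Ordinal ltin)) ?size_enum_ord // permE /=.
rewrite nth_enum_ord // prednK //.
by case/andP: (bs (Ordinal ltin)).
Qed.

Lemma size_st s : size (st s) = size s.
Proof. exact: size_map. Qed.

Lemma st_spec (s : seq nat) : uniq s ->
  perm_eq (st s) (iota 1 (size s)) /\
  (forall i l, i < size s -> l < size s ->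
     (nth 0 s i < nth 0 s l) = (nth 0 (st s) i < nth 0 (st s) l)).
Proof.
move=> us.
have mono x y : y \in s -> x < y -> count (leq^~ x) s < count (leq^~ y) s.
  move=> ys ltxy.
  have -> : count (leq^~ y) s = count (leq^~ x) s + count (fun z => x < z <= y) s.
    rewrite -count_predUI [X in _ + X](eq_count (a2 := pred0)) ?count_pred0 ?addn0.
      apply: eq_count => z /=; case: (leqP z x) => //= zx.
      by rewrite (leq_trans zx) // ltnW.
    by move=> z /=; case: (leqP z x).
  rewrite -[X in X < _]addn0 ltn_add2l -has_count.
  by apply/hasP; exists y => //; rewrite ltxy leqnn.
have iso i l : i < size s -> l < size s ->
     (nth 0 s i < nth 0 s l) = (nth 0 (st s) i < nth 0 (st s) l).
  move=> li ll; rewrite !(nth_map 0) //.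
  case: (ltngtP (nth 0 s i) (nth 0 s l)) => [h|h|->]; last by rewrite ltnn.
    by rewrite mono ?mem_nth.
  by apply/esym/negbTE; rewrite -leqNgt ltnW // mono ?mem_nth.
split=> //.
have ust: uniq (st s).
  rewrite map_inj_in_uniq // => x y xs ys e.
  by case: (ltngtP x y) => // h; [have:=mono _ _ ys h|have:=mono _ _ xs h];
     rewrite e ltnn.
have sub: {subset st s <= iota 1 (size s)}.
  move=> z /mapP[x xs ->]; rewrite mem_iota add1n ltnS count_size andbT -has_count.
  by apply/hasP; exists x.
apply: uniq_perm => //; first exact: iota_uniq.
by have [] := uniq_min_size ust sub; rewrite ?size_iota ?size_st.
Qed.

Lemma st_unique (s p : seq nat) : uniq s ->
  perm_eq p (iota 1 (size s)) ->
  (forall i l, i < size s -> l < size s ->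
     (nth 0 s i < nth 0 s l) = (nth 0 p i < nth 0 p l)) ->
  p = st s.
Proof.
move=> us pp iso.
have szp : size p = size s by rewrite (perm_size pp) size_iota.
apply: (@eq_from_nth _ 0) => [|i]; rewrite ?size_st // szp => li.
rewrite (nth_map 0) //.
have -> : count (leq^~ (nth 0 s i)) s = count (leq^~ (nth 0 p i)) p.
  rewrite -{2}(mkseq_nth 0 s) -{2}(mkseq_nth 0 p) !count_map szp.
  apply: eq_in_count => l; rewrite mem_iota => /andP[_ ll] /=.
  by rewrite leqNgt iso // -leqNgt.
rewrite (seq.permP pp).
have : nth 0 p i \in p by rewrite mem_nth ?szp.
rewrite (perm_mem pp) mem_iota add1n ltnS => /andP[_ ln].
rewrite -(subnKC ln) iotaD count_cat.
rewrite (_ : count _ (iota 1 _) = nth 0 p i); last first.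
  rewrite -[RHS](size_iota 1); apply/eqP; rewrite -all_count.
  by apply/allP => x; rewrite mem_iota add1n ltnS => /andP[].
rewrite (_ : count _ _ = 0) ?addn0 //; apply/eqP; rewrite -leqn0 leqNgt -has_count.
apply/hasPn => x; rewrite mem_iota add1n => /andP[h _].
by rewrite -ltnNge.
Qed.

Lemma perm_tau k m (nu : 'S_m) : perm_eq (tau k nu) (iota 1 (k * m)).
Proof.
elim: k => [|k IH] //; rewrite /tau -[k.+1]addn1 iotaD map_cat flatten_cat /=.
rewrite cats0 add0n mulnDl mul1n iotaD; apply: perm_cat => //.
rewrite addnC iotaDl /shift (eq_map (g := addn (k * m))) => [|x].
  by apply: perm_map; exact: perm_oneline.
exact: addnC.
Qed.

(* Main.v *)
Require Import Defs.
From mathcomp Require Import all_boot all_fingroup zify.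
Set Implicit Arguments.
Unset Strict Implicit.
Unset Printing Implicit Defensive.

(** Fix a set S of positions. In a permutation with an occurrence of
    [tau k lambda] at every position of S, the blocks (occurrences of lambda)
    making up these occurrences pairwise share at most one letter, because
    lambda has no self-overlaps; a shared letter is the last one of one block
    and the first one of another. Rearranging the letters of each block
    according to mu fixes the first and last letter of the block, so this is
    well defined on all blocks simultaneously; it keeps the set of values of
    each block, hence it turns the occurrences of [tau k lambda] into
    occurrences of [tau k mu]. So, for each S, as many permutations have an
    occurrence at every position of S for lambda as for mu, and
    inclusion-exclusion concludes. *)

(** * Inclusion-exclusion over sets of positions *)

Section SupersetCounting.

Variables (T I : finType).

Lemma card_superset_fibers (f : T -> {set I}) (S : {set I}) :
  #|[set x | S \subset f x]| =
  #|[set x | f x == S]| + \sum_(U : {set I} | S \proper U) #|[set x | f x == U]|.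
Proof.
rewrite -sum1_card (partition_big f (fun U => S \subset U)) => [|x]; last first.
  by rewrite inE.
rewrite (bigD1 S) //=; congr (_ + _).
  rewrite -sum1_card; apply: eq_bigl => x; rewrite !inE.
  by case: eqP => [->|]; rewrite ?subxx ?andbF.
apply: eq_big => [U|U /andP[SU _]].
  by rewrite properEneq andbC eq_sym.
rewrite -sum1_card; apply: eq_bigl => x; rewrite !inE.
by case: eqP => [->|]; rewrite ?SU ?andbF.
Qed.

(** Induction on the size of the complement of [S]: the fibers over proper supersets of [S] already
    agree, so they cancel from the two superset counts. *)
Lemma eq_card_fibers (f g : T -> {set I}) :
  (forall S : {set I},
     #|[set x | S \subset f x]| = #|[set x | S \subset g x]|) ->
  forall S : {set I}, #|[set x | f x == S]| = #|[set x | g x == S]|.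
Proof.
move=> fg S; have [n] := ubnP #|~: S|; elim: n S => // n IH S ltS.
have := fg S; rewrite !card_superset_fibers.
rewrite [X in _ = _ + X -> _](eq_bigr (fun U => #|[set x | f x == U]|)).
  exact: addIn.
move=> U SU; apply/esym/IH; apply: (leq_trans (n := #|~: S|)) => //.
by apply: proper_card; rewrite properC.
Qed.

End SupersetCounting.

(** * Occurrences as order conditions, and how far apart they lie *)

Lemma occurs_atP (p s : seq nat) (i : nat) :
  uniq s -> perm_eq p (iota 1 (size p)) ->
  reflect (i + size p <= size s /\
           forall a c, a < size p -> c < size p ->
             (nth 0 s (i + a) < nth 0 s (i + c)) = (nth 0 p a < nth 0 p c))
          (occurs_at p s i).
Proof.
move=> us pp; rewrite /occurs_at; case: leqP => [les|gts] /=; last first.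
  by constructor; case.
set w := take _ _.
have szw : size w = size p by rewrite size_takel // size_drop; lia.
have uw : uniq w by rewrite take_uniq ?drop_uniq.
have nw a : a < size p -> nth 0 w a = nth 0 s (i + a).
  by move=> ltap; rewrite nth_take // nth_drop.
apply: (iffP eqP) => [stw|[_ iso]].
  split=> // a c la lc; rewrite -!nw //.
  by rewrite -stw; apply: (st_spec uw).2; rewrite szw.
apply/esym/st_unique => //; rewrite szw // => a c la lc.
by rewrite !nw // iso.
Qed.

(** Two closer occurrences would both fit in a window of length at most [2 * size p - 2];
    standardizing that window gives a permutation forbidden by [no_self_overlaps]. *)
Lemma no_self_overlaps_occurs (p s : seq nat) (b c : nat) :
  perm_eq p (iota 1 (size p)) -> no_self_overlaps p -> uniq s ->
  occurs_at p s b -> occurs_at p s c -> b < c -> b + (size p).-1 <= c.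
Proof.
move=> pp nso us ob oc ltbc; rewrite leqNgt; apply/negP => ltc.
have [leb isob] := occurs_atP b us pp ob.
have [lec isoc] := occurs_atP c us pp oc.
set w := take (c - b + size p) (drop b s).
have szw : size w = c - b + size p by rewrite size_takel // size_drop; lia.
have uw : uniq w by rewrite take_uniq ?drop_uniq.
have nw a : a < c - b + size p -> nth 0 w a = nth 0 s (b + a).
  by move=> ltap; rewrite nth_take // nth_drop.
have [pst iso] := st_spec uw.
have [sigma sigmaE] := oneline_surj pst.
have ust : uniq (st w) by rewrite (perm_uniq pst) iota_uniq.
have o0 : occurs_at p (st w) 0.
  apply/occurs_atP => //; rewrite size_st szw; split; first lia.
  move=> a e la le; rewrite -iso ?szw; [|lia..].
  by rewrite !nw; [apply: isob|lia..].
have od : occurs_at p (st w) (c - b).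
  apply/occurs_atP => //; rewrite size_st szw; split; first lia.
  move=> a e la le; rewrite -iso ?szw; [|lia..].
  by rewrite !nw ?[b + (c - b + _)]addnA ?subnKC; [apply: isoc|lia..].
have : size (occurrences p (oneline sigma)) <= 1 by apply: nso; lia.
have : size [:: 0; c - b] <= size (occurrences p (oneline sigma)).
  apply: uniq_leq_size => [|x]; first by rewrite /= inE; lia.
  rewrite sigmaE !inE mem_filter mem_iota size_st szw.
  by case/orP => /eqP->; rewrite ?o0 ?od; lia.
by move=> /=; lia.
Qed.

(** * Moving positions inside blocks *)

Section BlockMap.

Variables (m : nat) (B : seq nat).
Hypothesis B_sep : {in B &, forall b c, b < c -> b + m.-1 <= c}.

Definition block_map (rho : nat -> nat) (x : nat) : nat :=
  if [seq b <- B | b <= x < b + m] is b :: _ then b + rho (x - b) else x.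

(** The choice of the first block containing the position is harmless: a position in two blocks is
    the last of one and the first of the other, and [rho] fixes both ends. *)
Lemma block_mapE (rho : nat -> nat) (b r : nat) :
  rho 0 = 0 -> rho m.-1 = m.-1 -> b \in B -> r < m ->
  block_map rho (b + r) = b + rho r.
Proof.
move=> rho0 rhom bB ltrm; rewrite /block_map.
have : b \in [seq c <- B | c <= b + r < c + m] by rewrite mem_filter bB; lia.
case E: [seq _ <- _ | _] => [//|c t] _.
have : c \in c :: t by exact: mem_head.
rewrite -E mem_filter => /andP[/andP[lec gec] cB].
case: (ltngtP b c) => [ltbc|ltcb|<-]; last by rewrite addKn.
- have := B_sep bB cB ltbc => sep.
  have -> : b + r - c = 0 by lia.
  have -> : r = m.-1 by lia.
  by rewrite rho0 rhom; lia.
- have := B_sep cB bB ltcb => sep.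
  have -> : b + r - c = m.-1 by lia.
  have -> : r = 0 by lia.
  by rewrite rho0 rhom; lia.
Qed.

Lemma block_map_out (rho : nat -> nat) (x : nat) :
  ~~ has (fun b => b <= x < b + m) B -> block_map rho x = x.
Proof. by rewrite has_filter negbK /block_map => /eqP->. Qed.

Variant block_spec (x : nat) : Prop :=
| InBlock b r of b \in B & r < m & x = b + r
| OutBlock of ~~ has (fun b => b <= x < b + m) B.

Lemma blockP (x : nat) : block_spec x.
Proof.
case: (boolP (has (fun b => b <= x < b + m) B)) => [/hasP[b bB lebx]|].
  by apply: (@InBlock x b (x - b)) => //; lia.
exact: OutBlock.
Qed.

Lemma block_mapK (rho rho' : nat -> nat) :
  rho 0 = 0 -> rho m.-1 = m.-1 -> rho' 0 = 0 -> rho' m.-1 = m.-1 ->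
  (forall r, r < m -> rho r < m) -> (forall r, r < m -> rho' (rho r) = r) ->
  cancel (block_map rho) (block_map rho').
Proof.
move=> r0 rm r0' rm' bnd rK x; case: (blockP x) => [b r bB ltrm ->|out].
  by rewrite !block_mapE ?rK ?bnd.
by rewrite !block_map_out.
Qed.

Lemma block_map_lt (rho : nat -> nat) (n x : nat) :
  rho 0 = 0 -> rho m.-1 = m.-1 -> (forall r, r < m -> rho r < m) ->
  {in B, forall b, b + m <= n} -> x < n -> block_map rho x < n.
Proof.
move=> r0 rm bnd Bn; case: (blockP x) => [b r bB ltrm -> _|out]; last first.
  by rewrite block_map_out.
by rewrite block_mapE //; have := bnd r ltrm; have := Bn b bB; lia.
Qed.

End BlockMap.

(** For rearrangements of the same letters this is the map on positions whose composition with [l]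
    yields [l']. *)
Definition reindex (l l' : seq nat) (r : nat) : nat := index (nth 0 l' r) l.

Section Reindex.

Variables l l' : seq nat.
Hypotheses (ul : uniq l) (pl : perm_eq l' l).

Lemma reindex_lt r : r < size l -> reindex l l' r < size l.
Proof. by move=> h; rewrite index_mem -(perm_mem pl) mem_nth // (perm_size pl). Qed.

Lemma nth_reindex r : r < size l -> nth 0 l (reindex l l' r) = nth 0 l' r.
Proof. by move=> h; rewrite nth_index // -(perm_mem pl) mem_nth // (perm_size pl). Qed.

Lemma reindex_fix r : r < size l -> nth 0 l r = nth 0 l' r -> reindex l l' r = r.
Proof. by move=> h e; rewrite /reindex -e index_uniq. Qed.

Lemma reindexK r : r < size l -> reindex l' l (reindex l l' r) = r.
Proof.
move=> h; rewrite {1}/reindex nth_reindex // index_uniq ?(perm_size pl) //.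
by rewrite (perm_uniq pl).
Qed.

End Reindex.

(** * Blocks and occurrence sets of [tau] *)

Lemma size_tau k m (nu : 'S_m) : size (tau k nu) = k * m.
Proof. by rewrite (perm_size (perm_tau k nu)) size_iota. Qed.

Lemma nth_tau k m (nu : 'S_m) j r : j < k -> r < m ->
  nth 0 (tau k nu) (j * m + r) = nth 0 (oneline nu) r + j * m.
Proof.
elim: k => // k IH ltjk ltrm.
have -> : tau k.+1 nu = tau k nu ++ shift (k * m) (oneline nu).
  by rewrite /tau -addn1 iotaD map_cat flatten_cat /= cats0.
rewrite nth_cat size_tau; case: (ltngtP j k) => [ltj|gtj|->].
- by rewrite IH // ifT //; nia.
- by lia.
by rewrite ltnNge leq_addr addKn (nth_map 0) ?size_oneline.
Qed.

Lemma uniq_oneline n (sigma : 'S_n) : uniq (oneline sigma).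
Proof. by rewrite (perm_uniq (perm_oneline sigma)) iota_uniq. Qed.

Lemma perm_tau_size k m (nu : 'S_m) : perm_eq (tau k nu) (iota 1 (size (tau k nu))).
Proof. by rewrite size_tau perm_tau. Qed.

Lemma perm_oneline_size m (nu : 'S_m) :
  perm_eq (oneline nu) (iota 1 (size (oneline nu))).
Proof. by rewrite size_oneline perm_oneline. Qed.

Lemma tau_occurs_block k m (nu : 'S_m) (s : seq nat) i j :
  uniq s -> occurs_at (tau k nu) s i -> j < k ->
  occurs_at (oneline nu) s (i + j * m).
Proof.
move=> us /(occurs_atP _ us (perm_tau_size _ _))[]; rewrite size_tau => le iso ltjk.
apply/(occurs_atP _ us (perm_oneline_size _)).
rewrite size_oneline; split=> [|a c la lc]; first nia.
rewrite -!addnA iso ?nth_tau ?ltn_add2r //; nia.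
Qed.

Lemma nth_oneline n (sigma : 'S_n) (i : 'I_n) :
  nth 0 (oneline sigma) i = (sigma i).+1.
Proof. by rewrite (nth_map i) ?size_enum_ord // nth_ord_enum. Qed.

(** The index type has [n.+1] elements to match the range scanned by [occurrences]. *)
Definition occ_set n (p : seq nat) (sigma : 'S_n) : {set 'I_n.+1} :=
  [set i : 'I_n.+1 | occurs_at p (oneline sigma) i].

Lemma avoids_occ_set n (p : seq nat) (sigma : 'S_n) :
  avoids (oneline sigma) p = (occ_set p sigma == set0).
Proof.
rewrite /avoids /contains negbK /occurrences size_oneline.
apply/eqP/eqP => [e|/setP e].
  apply/setP => i; rewrite !inE; apply: negbTE; apply/negP => oi.
  have : (i : nat) \in [seq i <- iota 0 n.+1 | occurs_at p (oneline sigma) i].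
    by rewrite mem_filter oi mem_iota add0n ltn_ord.
  by rewrite e.
apply/eqP; rewrite -[_ == _]negbK -has_filter; apply/hasPn => i.
rewrite mem_iota add0n => /andP[_ lti].
by have := e (Ordinal lti); rewrite !inE /= => ->.
Qed.

(** * The injection for a fixed set of positions *)

Section Rearrangement.

Variables (m k n : nat) (lambda mu : 'S_m).
Hypotheses (m_gt0 : 0 < m) (nso : no_self_overlaps (oneline lambda))
  (hfirst : head 0 (oneline lambda) = head 0 (oneline mu))
  (hlast : last 0 (oneline lambda) = last 0 (oneline mu)).

(** The blocks are determined by [S], so one permutation [pi] of positions serves every [sigma], and
    [sigma] maps injectively to [pi * sigma]. *)
Lemma card_occ_superset_le (S : {set 'I_n.+1}) :
  #|[set sigma : 'S_n | S \subset occ_set (tau k lambda) sigma]| <=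
  #|[set sigma : 'S_n | S \subset occ_set (tau k mu) sigma]|.
Proof.
(* A single witness [sigma0] suffices to show that the blocks are separated and end by position [n],
   which are properties of [S] alone. *)
have [->|[sigma0]] := set_0Vmem [set sigma : 'S_n | S \subset occ_set (tau k lambda) sigma].
  by rewrite cards0.
rewrite inE => /subsetP S0.
(* Starting positions of all blocks of the occurrences prescribed by [S]. *)
pose B := [seq val i + j * m | i <- enum S, j <- iota 0 k].
have BP b : b \in B ->
    exists2 i, i \in S & exists2 j, j < k & b = val i + j * m.
  case/allpairsP => -[i j] /= [iS jk ->]; exists i; rewrite ?mem_enum in iS *=> //.
  by exists j => //; rewrite mem_iota in jk.
have Bmem (i : 'I_n.+1) j : i \in S -> j < k -> val i + j * m \in B.
  by move=> iS jk; apply/allpairsP; exists (i, j); rewrite mem_enum mem_iota.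
have Bocc b : b \in B -> occurs_at (oneline lambda) (oneline sigma0) b.
  case/BP => i iS [j jk ->]; apply: (@tau_occurs_block k) => //.
    exact: uniq_oneline.
  by have := S0 i iS; rewrite inE.
have Bsep : {in B &, forall b c, b < c -> b + m.-1 <= c}.
  move=> b c /Bocc ob /Bocc oc; rewrite -(size_oneline lambda).
  apply: no_self_overlaps_occurs ob oc => //; last exact: uniq_oneline.
  exact: perm_oneline_size.
have Bn : {in B, forall b, b + m <= n}.
  by move=> b /Bocc /andP[]; rewrite !size_oneline.
have pml : perm_eq (oneline mu) (oneline lambda).
  by rewrite (perm_trans (perm_oneline mu)) // perm_sym perm_oneline.
have plm : perm_eq (oneline lambda) (oneline mu) by rewrite perm_sym.
have szl := size_oneline lambda; have szm := size_oneline mu.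
have e0 : nth 0 (oneline lambda) 0 = nth 0 (oneline mu) 0 by rewrite !nth0.
have em : nth 0 (oneline lambda) m.-1 = nth 0 (oneline mu) m.-1.
  by have := hlast; rewrite -!nth_last szl szm.
have ltm : m.-1 < m by rewrite prednK.
pose rho := reindex (oneline lambda) (oneline mu).
pose rho' := reindex (oneline mu) (oneline lambda).
have r0 : rho 0 = 0 by apply: reindex_fix; rewrite ?uniq_oneline ?szl.
have rm : rho m.-1 = m.-1 by apply: reindex_fix; rewrite ?uniq_oneline ?szl.
have r0' : rho' 0 = 0 by apply: reindex_fix; rewrite ?uniq_oneline ?szm.
have rm' : rho' m.-1 = m.-1 by apply: reindex_fix; rewrite ?uniq_oneline ?szm.
have bnd r : r < m -> rho r < m.
  by move=> h; rewrite -[X in _ < X]szl reindex_lt ?szl.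
have rK r : r < m -> rho' (rho r) = r.
  by move=> h; apply: reindexK; rewrite ?uniq_oneline ?szl.
have lt_phi (x : 'I_n) : block_map m B rho x < n by apply: block_map_lt.
have phi_inj : injective (fun x => Ordinal (lt_phi x)).
  move=> x y /(congr1 val) /= /(can_inj (block_mapK Bsep r0 rm r0' rm' bnd rK)).
  exact: val_inj.
pose pi := perm phi_inj.
rewrite -(card_imset _ (mulgI pi)); apply/subset_leq_card/subsetP => ?.
case/imsetP => sigma; rewrite inE => /subsetP Ssigma ->; rewrite inE.
apply/subsetP => i iS; rewrite inE.
have := Ssigma i iS; rewrite inE.
have us := uniq_oneline sigma.
move=> /(occurs_atP _ us (perm_tau_size _ _))[].
rewrite size_tau size_oneline => le iso.
apply/(occurs_atP _ (uniq_oneline _) (perm_tau_size _ _)).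
rewrite size_tau size_oneline; split=> // a c la lc.
(* Offset [x] lies in block [x %/ m] at place [x %% m]; [pi] acts first in [pi * sigma], so the
   letter is read at the image of the position. *)
have nthE x : x < k * m ->
    nth 0 (oneline (pi * sigma)%g) (i + x) =
    nth 0 (oneline sigma) (i + (x %/ m * m + rho (x %% m))).
  move=> lx; have lix : i + x < n by lia.
  rewrite (nth_oneline _ (Ordinal lix)) permM -nth_oneline permE /=.
  rewrite {1}(divn_eq x m) !addnA block_mapE ?ltn_mod //.
  by rewrite Bmem // ltn_divLR.
have ltx x : x < k * m -> x %/ m * m + rho (x %% m) < k * m.
  move=> lx; have := bnd (x %% m); rewrite ltn_mod => /(_ m_gt0).
  by have : x %/ m < k by [rewrite ltn_divLR]; nia.
have tauE x : x < k * m ->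
    nth 0 (tau k lambda) (x %/ m * m + rho (x %% m)) = nth 0 (tau k mu) x.
  move=> lx; have lk : x %/ m < k by rewrite ltn_divLR.
  rewrite [in RHS](divn_eq x m) !nth_tau ?bnd ?ltn_mod //.
  by rewrite nth_reindex // szl ltn_mod.
by rewrite !nthE // iso ?ltx // !tauE.
Qed.

End Rearrangement.

Theorem theorem4p22 (m k : nat) (hm : 1 <= m) (hk : 1 <= k)
  (lambda mu : 'S_m)
  (hlambda : no_self_overlaps (oneline lambda))
  (hmu : no_self_overlaps (oneline mu))
  (hfirst : head 0 (oneline lambda) = head 0 (oneline mu))
  (hlast : last 0 (oneline lambda) = last 0 (oneline mu)) :
  forall n : nat,
    #|avoiders n (tau k lambda)| = #|avoiders n (tau k mu)|.
Proof.
move=> n; have avE nu :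
    avoiders n (tau k nu) = [set sigma | occ_set (tau k nu) sigma == set0].
  by apply/setP => sigma; rewrite !inE avoids_occ_set.
rewrite !avE; apply: eq_card_fibers => S; apply/eqP.
(* The two inequalities are the same lemma with [lambda] and [mu] exchanged. *)
by rewrite eqn_leq !card_occ_superset_le.
Qed.
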